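(* Let $\mathcal L$ be a semilattice, $(\mathfrak A,(A_i)_{i\in\mathcal L})$ an $\mathcal L$-graded $C^*$-algebra, $\mathcal M$ a final subsemilattice of $\mathcal L$, and $\mathcal M'=\mathcal L\setminus\mathcal M$ its complement. There exists a unique homomorphism $p:\mathfrak A\to\overline{\mathfrak A_{\mathcal M}}$ whose restriction to $A_i$ equals $\mathrm{Id}_{A_i}$ if $i\in\mathcal M$ and $0$ if $i\in\mathcal M'$. Moreover $\ker p=\overline{\mathfrak A_{\mathcal M'}}$. In other words, $\mathfrak A=\overline{\mathfrak A_{\mathcal M'}}\oplus\overline{\mathfrak A_{\mathcal M}}$ and there is a split exact sequence $$0\to\overline{\mathfrak A_{\mathcal M'}}\xrightarrow{\ i\ }\mathfrak A\ \underset{\sigma}{\overset{p}{\rightleftarrows}}\ \overline{\mathfrak A_{\mathcal M}}\to 0,$$ where $i$ and $\sigma$ are the natural inclusions.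
   Context: A semilattice is a partially ordered set $\mathcal L$ in which any two elements $k,\ell$ have a greatest lower bound $k\wedge\ell$. A final subsemilattice (''sous-semi-treillis finissant'') is a subset $\mathcal M\subset\mathcal L$ closed under $\wedge$ and upward closed (if $a\in\mathcal M$ and $a\le b$ then $b\in\mathcal M$). A $C^*$-algebra $\mathfrak A$ is $\mathcal L$-graded with components $(A_i)_{i\in\mathcal L}$, written $(\mathfrak A,(A_i)_{i\in\mathcal L})$, if $(A_i)_{i\in\mathcal L}$ is a family of sub-$C^*$-algebras of $\mathfrak A$ which is linearly independent (if $S_i\in A_i$, only finitely many $S_i$ are nonzero and $\sum_i S_i=0$, then all $S_i=0$), total (the linear span of $\bigcup_i A_i$ is dense in $\mathfrak A$), and satisfies $A_iA_j\subset A_{i\wedge j}$ for all $i,j\in\mathcal L$. For $\mathcal N\subset\mathcal L$, $\mathfrak A_{\mathcal N}=\bigoplus_{i\in\mathcal N}A_i\subset\mathfrak A$ (algebraic sum), and $\overline{\mathfrak A_{\mathcal N}}$ is its closure; $\overline{\mathfrak A_{\mathcal M}}$ is a sub-$C^*$-algebra and $\overline{\mathfrak A_{\mathcal M'}}$ a closed ideal of $\mathfrak A$. Homomorphisms are $*$-homomorphisms. *)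

(* Defs.v *)
From HB Require Import structures.
From mathcomp Require Import all_boot all_order all_algebra complex.
From mathcomp Require Import all_classical all_reals topology normedtype.

Set Implicit Arguments.
Unset Strict Implicit.
Unset Printing Implicit Defensive.

Import Order.TTheory GRing.Theory Num.Theory numFieldNormedType.Exports.

Local Open Scope classical_set_scope.
Local Open Scope ring_scope.

(* C*-algebras are not assumed unital, which is why the product is not taken
   from the ring hierarchy.  The norm takes its values in R[i]; they are
   nonnegative, hence real. *)
HB.mixin Record isCstarAlgebra (R : realType) A
    & CompleteNormedModule R[i] A := {
  cmul : A -> A -> A;
  cstar : A -> A;
  cmulA : associative cmul;
  cmulDl : left_distributive cmul +%R;
  cmulDr : right_distributive cmul +%R;
  cmulZl : forall (c : R[i]) (x y : A), cmul (c *: x) y = c *: cmul x y;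
  cmulZr : forall (c : R[i]) (x y : A), cmul x (c *: y) = c *: cmul x y;
  cstarK : involutive cstar;
  cstarD : {morph cstar : x y / x + y};
  cstarZ : forall (c : R[i]) (x : A), cstar (c *: x) = c^* *: cstar x;
  cstarM : forall x y : A, cstar (cmul x y) = cmul (cstar y) (cstar x);
  norm_cmul : forall x y : A, `|cmul x y| <= `|x| * `|y|;
  norm_cstar_mul : forall x : A, `|cmul (cstar x) x| = `|x| ^+ 2
}.

#[short(type="cstarAlgType")]
HB.structure Definition CstarAlgebra (R : realType) :=
  {A of CompleteNormedModule R[i] A & isCstarAlgebra R A}.

Definition star_hom (R : realType) (A B : cstarAlgType R) (f : A -> B) : Prop :=
  [/\ linear f,
      forall x y : A, f (cmul x y) = cmul (f x) (f y)
    & forall x : A, f (cstar x) = cstar (f x)].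

Definition hom_kernel (R : realType) (A B : cstarAlgType R) (f : A -> B) :
  set A := [set x | f x = 0].

(* 0 -> J -i-> A -p-> B -> 0 is exact and split by s *)
Definition split_exact (R : realType) (J A B : cstarAlgType R)
    (i : J -> A) (p : A -> B) (s : B -> A) : Prop :=
  [/\ star_hom i, star_hom p & star_hom s] /\
  [/\ injective i,
      range i = hom_kernel p,
      range p = setT
    & forall b : B, p (s b) = b].

Definition direct_sum_decomposition (V : zmodType) (U W : set V) : Prop :=
  forall a : V, exists! uw : V * V, [/\ U uw.1, W uw.2 & a = uw.1 + uw.2].

Record is_subCstar (R : realType) (A : cstarAlgType R) (B : set A) : Prop := {
  subCstar0 : B 0;
  subCstarD : forall x y, B x -> B y -> B (x + y);
  subCstarZ : forall (c : R[i]) x, B x -> B (c *: x);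
  subCstarM : forall x y, B x -> B y -> B (cmul x y);
  subCstar_star : forall x, B x -> B (cstar x);
  subCstar_closed : closed B
}.

Record subCstar (R : realType) (A : cstarAlgType R) := SubCstar {
  subCstar_set :> set A;
  subCstarP : is_subCstar subCstar_set
}.

Section CstarTheory.
Variables (R : realType) (A : cstarAlgType R).
Implicit Types (x y : A) (S : set A).

Lemma cmul0r x : cmul 0 x = 0.
Proof. by rewrite -(scale0r (0 : A)) cmulZl !scale0r. Qed.

Lemma cmulr0 x : cmul x 0 = 0.
Proof. by rewrite -(scale0r (0 : A)) cmulZr !scale0r. Qed.

Lemma cmulNr x y : cmul (- x) y = - cmul x y.
Proof. by rewrite -scaleN1r cmulZl scaleN1r. Qed.

Lemma cmulrN x y : cmul x (- y) = - cmul x y.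
Proof. by rewrite -scaleN1r cmulZr scaleN1r. Qed.

Lemma cstar0 : cstar (0 : A) = 0.
Proof. by rewrite -(scale0r (0 : A)) cstarZ conjC0 !scale0r. Qed.

Lemma cstarN x : cstar (- x) = - cstar x.
Proof. by rewrite -scaleN1r cstarZ rmorphN rmorph1 scaleN1r. Qed.

Lemma norm_cstar x : `|cstar x| = `|x|.
Proof.
have le y : `|y| <= `|cstar y|.
  have [->|y0] := eqVneq y 0; first by rewrite cstar0.
  have ny : 0 < `|y| by rewrite normr_gt0.
  by rewrite -(ler_pM2r ny) -expr2 -norm_cstar_mul norm_cmul.
by apply: le_anti; rewrite le andbT -{2}(cstarK x) le.
Qed.

Lemma closure_normP S x :
  closure S x <-> forall e : R[i], 0 < e -> exists2 y, S y & `|x - y| < e.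
Proof.
split=> [Sx e e0|Sx U /nbhs_ballP[e /= e0 eU]].
  have [y [Sy]] := Sx _ (nbhsx_ballx x e e0).
  by rewrite -ball_normE; exists y.
have [y Sy xy] := Sx _ e0.
by exists y; split=> //; apply: eU; rewrite -ball_normE.
Qed.

Lemma closure_lipschitz S (f : A -> A) (k : R[i]) x : 0 <= k ->
  (forall y, `|f x - f y| <= k * `|x - y|) ->
  (forall y, S y -> closure S (f y)) -> closure S x -> closure S (f x).
Proof.
move=> k0 flip fS /closure_normP Sx.
have k1 : 0 < k + 1 by rewrite ltr_wpDl.
suff : closure (closure S) (f x) by rewrite -(closure_id _).1//; exact: closed_closure.
apply/closure_normP => e e0.
have [y Sy xy] := Sx _ (divr_gt0 e0 k1).
exists (f y); first exact: fS.
apply: (le_lt_trans (flip y)); rewrite ltr_pdivlMr// mulrC in xy.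
by apply: le_lt_trans xy; rewrite ler_wpM2r// lerDl.
Qed.

Lemma is_subCstar_closure S :
  S 0 -> (forall x y, S x -> S y -> S (x + y)) ->
  (forall (c : R[i]) x, S x -> S (c *: x)) ->
  (forall x y, S x -> S y -> S (cmul x y)) ->
  (forall x, S x -> S (cstar x)) -> is_subCstar (closure S).
Proof.
move=> S0 SD SZ SM Sstar.
have cS y : S y -> closure S y by exact: subset_closure.
split.
- exact: cS.
- move=> x y Sx Sy; apply: (@closure_lipschitz _ (fun z => x + z) 1) => //.
    by move=> z; rewrite mul1r opprD addrACA subrr add0r.
  move=> z Sz; apply: (@closure_lipschitz _ (fun w => w + z) 1) => //.
    by move=> w; rewrite mul1r opprD addrACA subrr addr0.
  by move=> w Sw; apply: cS; exact: SD.
- move=> c x; apply: (@closure_lipschitz _ (fun z => c *: z) `|c|) => //.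
    by move=> z; rewrite -scalerBr normrZ.
  by move=> w Sw; apply: cS; exact: SZ.
- move=> x y Sx Sy; apply: (@closure_lipschitz _ (cmul x) `|x|) => //.
    by move=> z; rewrite -cmulrN -cmulDr norm_cmul.
  move=> z Sz; apply: (@closure_lipschitz _ (cmul^~ z) `|z|) => //.
    by move=> w; rewrite -cmulNr -cmulDl mulrC norm_cmul.
  by move=> w Sw; apply: cS; exact: SM.
- move=> x; apply: (@closure_lipschitz _ (@cstar _ A) 1) => //.
    by move=> z; rewrite mul1r -cstarN -cstarD norm_cstar.
  by move=> w Sw; apply: cS; exact: Sstar.
- exact: closed_closure.
Qed.

End CstarTheory.

(* A sub-C*-algebra seen as a C*-algebra in its own right, with the operations
   and the norm of the ambient algebra. *)
Section SubCstarType.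
Variables (R : realType) (A : cstarAlgType R) (B : subCstar A).

Definition subCstar_pred : {pred A} := fun x => x \in (B : set A).

Record subCstar_type := SubCstarElt {
  subCstar_val :> A;
  subCstar_valP : subCstar_val \in subCstar_pred
}.

HB.instance Definition _ := [isSub for subCstar_val].
HB.instance Definition _ := [Choice of subCstar_type by <:].

Lemma subCstar_predE x : (x \in subCstar_pred) = (x \in (B : set A)).
Proof. by []. Qed.

Fact subCstar_submod_closed : GRing.subsemimod_closed subCstar_pred.
Proof.
have BP := subCstarP B.
split; first split.
- by rewrite subCstar_predE; apply/mem_set/(subCstar0 BP).
- move=> x y; rewrite !subCstar_predE => /set_mem Bx /set_mem By.
  exact/mem_set/(subCstarD BP).
- move=> c x; rewrite !subCstar_predE => /set_mem Bx.
  exact/mem_set/(subCstarZ BP).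
Qed.

HB.instance Definition _ := GRing.SubChoice_isSubLmodule.Build
  R[i] A subCstar_pred subCstar_type subCstar_submod_closed.

Lemma subCstar_valB (x y : subCstar_type) :
  subCstar_val (x - y) = subCstar_val x - subCstar_val y.
Proof. exact: (raddfB (\val : subCstar_type -> A)). Qed.

Lemma subCstar_valZ (c : R[i]) (x : subCstar_type) :
  subCstar_val (c *: x) = c *: subCstar_val x.
Proof. exact: (linearZZ (\val : subCstar_type -> A)). Qed.

Lemma subCstar_valD (x y : subCstar_type) :
  subCstar_val (x + y) = subCstar_val x + subCstar_val y.
Proof. exact: (raddfD (\val : subCstar_type -> A)). Qed.

Lemma subCstar_val0 : subCstar_val (0 : subCstar_type) = 0.
Proof. exact: (raddf0 (\val : subCstar_type -> A)). Qed.

Lemma subCstar_val_inj : injective subCstar_val.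
Proof. exact: val_inj. Qed.

Definition subCstar_norm (x : subCstar_type) : R[i] := `|subCstar_val x|.

Fact subCstar_ler_normD (x y : subCstar_type) :
  subCstar_norm (x + y) <= subCstar_norm x + subCstar_norm y.
Proof. by rewrite /subCstar_norm subCstar_valD ler_normD. Qed.

Fact subCstar_normZ (c : R[i]) (x : subCstar_type) :
  subCstar_norm (c *: x) = `|c| * subCstar_norm x.
Proof. by rewrite /subCstar_norm subCstar_valZ normrZ. Qed.

Fact subCstar_norm0 (x : subCstar_type) : subCstar_norm x = 0 -> x = 0.
Proof.
by move=> /normr0_eq0 x0; apply: subCstar_val_inj; rewrite subCstar_val0.
Qed.

HB.instance Definition _ := Lmodule_isNormed.Build R[i] subCstar_type
  subCstar_ler_normD subCstar_normZ subCstar_norm0.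

Lemma subCstar_normE (x : subCstar_type) : `|x| = `|subCstar_val x|.
Proof. by []. Qed.

Lemma subCstar_ball (x y : subCstar_type) (e : R[i]) :
  ball x e y <-> ball (subCstar_val x) e (subCstar_val y).
Proof. by rewrite -!ball_normE /= subCstar_normE subCstar_valB. Qed.

Fact subCstar_complete (F : set_system subCstar_type) :
  ProperFilter F -> cauchy F -> cvg F.
Proof.
move=> FF /cauchyP Fc.
have /cauchy_cvg/cvg_ex[l Fl] : cauchy (subCstar_val @ F).
  apply: cauchy_exP => e e0; have [x Fx] := Fc _ e0.
  exists (subCstar_val x); rewrite /fmap/=.
  by apply: filterS Fx => y /subCstar_ball.
have Bl : l \in subCstar_pred.
  rewrite subCstar_predE; apply/mem_set.
  apply: (subCstar_closed (subCstarP B)) => U Ul.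
  have /filter_ex[y Uy] : F (subCstar_val @^-1` U) by exact: Fl.
  exists (subCstar_val y); split=> //.
  by have := subCstar_valP y; rewrite subCstar_predE => /set_mem.
apply/cvg_ex; exists (SubCstarElt Bl); apply/cvg_ballP => e e0.
have Fle : F (subCstar_val @^-1` ball l e) by apply: Fl; exact: nbhsx_ballx.
by apply: filterS Fle => y ly; apply/subCstar_ball.
Qed.

HB.instance Definition _ :=
  Uniform_isComplete.Build subCstar_type subCstar_complete.

Fact subCstar_mul_subproof (x y : subCstar_type) :
  cmul (subCstar_val x) (subCstar_val y) \in subCstar_pred.
Proof.
case: x y => [x Bx] [y By] /=; move: Bx By.
rewrite !subCstar_predE => /set_mem Bx /set_mem By.
exact/mem_set/(subCstarM (subCstarP B)).
Qed.

Fact subCstar_star_subproof (x : subCstar_type) :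
  cstar (subCstar_val x) \in subCstar_pred.
Proof.
case: x => [x Bx] /=; move: Bx; rewrite !subCstar_predE => /set_mem Bx.
exact/mem_set/(subCstar_star (subCstarP B)).
Qed.

Definition subCstar_cmul x y := SubCstarElt (subCstar_mul_subproof x y).
Definition subCstar_cstar x := SubCstarElt (subCstar_star_subproof x).

Fact subCstar_cmulA : associative subCstar_cmul.
Proof. by move=> x y z; apply: subCstar_val_inj; rewrite /= cmulA. Qed.
Fact subCstar_cmulDl : left_distributive subCstar_cmul +%R.
Proof.
by move=> x y z; apply: subCstar_val_inj; rewrite /= cmulDl.
Qed.
Fact subCstar_cmulDr : right_distributive subCstar_cmul +%R.
Proof.
by move=> x y z; apply: subCstar_val_inj; rewrite /= cmulDr.
Qed.
Fact subCstar_cmulZl (c : R[i]) (x y : subCstar_type) :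
  subCstar_cmul (c *: x) y = c *: subCstar_cmul x y.
Proof. by apply: subCstar_val_inj; rewrite /= cmulZl. Qed.
Fact subCstar_cmulZr (c : R[i]) (x y : subCstar_type) :
  subCstar_cmul x (c *: y) = c *: subCstar_cmul x y.
Proof. by apply: subCstar_val_inj; rewrite /= cmulZr. Qed.
Fact subCstar_cstarK : involutive subCstar_cstar.
Proof. by move=> x; apply: subCstar_val_inj; rewrite /= cstarK. Qed.
Fact subCstar_cstarD : {morph subCstar_cstar : x y / x + y}.
Proof.
by move=> x y; apply: subCstar_val_inj; rewrite /= cstarD.
Qed.
Fact subCstar_cstarZ (c : R[i]) (x : subCstar_type) :
  subCstar_cstar (c *: x) = c^* *: subCstar_cstar x.
Proof. by apply: subCstar_val_inj; rewrite /= cstarZ. Qed.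
Fact subCstar_cstarM (x y : subCstar_type) : subCstar_cstar (subCstar_cmul x y)
  = subCstar_cmul (subCstar_cstar y) (subCstar_cstar x).
Proof. by apply: subCstar_val_inj; rewrite /= cstarM. Qed.
Fact subCstar_norm_cmul (x y : subCstar_type) :
  `|subCstar_cmul x y| <= `|x| * `|y|.
Proof. by rewrite !subCstar_normE norm_cmul. Qed.
Fact subCstar_norm_cstar_mul (x : subCstar_type) :
  `|subCstar_cmul (subCstar_cstar x) x| = `|x| ^+ 2.
Proof. by rewrite !subCstar_normE norm_cstar_mul. Qed.

HB.instance Definition _ := isCstarAlgebra.Build R subCstar_type
  subCstar_cmulA subCstar_cmulDl subCstar_cmulDr subCstar_cmulZl
  subCstar_cmulZr subCstar_cstarK subCstar_cstarD subCstar_cstarZ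
  subCstar_cstarM subCstar_norm_cmul subCstar_norm_cstar_mul.

End SubCstarType.

Section Semilattice.
Variables (d : Order.disp_t) (L : meetSemilatticeType d).

Definition meet_stable (N : set L) : Prop :=
  forall i j, N i -> N j -> N (Order.meet i j).

Definition final_subsemilattice (M : set L) : Prop :=
  meet_stable M /\ (forall i j, M i -> (i <= j)%O -> M j).

Lemma final_meet_stable M : final_subsemilattice M -> meet_stable M.
Proof. by case. Qed.

Lemma final_meet_stableC M : final_subsemilattice M -> meet_stable (~` M).
Proof.
by case=> _ up i j Mi _ Mij; apply: Mi; apply: up Mij _; exact: leIl.
Qed.

End Semilattice.

Section Graded.
Variables (R : realType) (A : cstarAlgType R).
Variables (d : Order.disp_t) (L : meetSemilatticeType d) (A_ : L -> set A).

Definition finite_family (S : L -> A) : Prop :=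
  (forall i, A_ i (S i)) /\ finite_set [set i | S i != 0].

Definition lin_span (E : set A) : set A :=
  [set v | exists (n : nat) (c : 'I_n -> R[i]) (x : 'I_n -> A),
    (forall k, E (x k)) /\ v = \sum_(k < n) c k *: x k].

Record graded : Prop := {
  graded_sub : forall i, is_subCstar (A_ i);
  graded_indep : forall S : L -> A, finite_family S ->
    \sum_(i \in setT) S i = 0 -> forall i, S i = 0;
  graded_total : dense (lin_span (\bigcup_i A_ i));
  graded_mul : forall i j a b, A_ i a -> A_ j b -> A_ (Order.meet i j) (cmul a b)
}.

Definition alg_sum (N : set L) : set A :=
  [set \sum_(i \in N) S i | S in finite_family].

Hypothesis gA : graded.
Variable N : set L.

Lemma alg_sumE S : finite_family S -> exists r : seq L,
  \sum_(i \in N) S i = \sum_(i <- r | i \in N) S i.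
Proof.
move=> [_ Sfin]; exists (finmap.enum_fset (fset_set [set i | S i != 0])).
rewrite fsbig_mkcond.
rewrite (@fsbigTE _ _ _ _ (fset_set [set i | S i != 0])).
  by rewrite [RHS]big_mkcond; apply: eq_bigr => i _; rewrite /patch.
move=> i; rewrite in_fset_set//= => Si.
rewrite /patch; case: ifP => // _.
by move: Si; rewrite notin_setE /= => /negP; rewrite negbK => /eqP.
Qed.

Lemma alg_sum0 : alg_sum N 0.
Proof.
exists (fun=> 0); last by rewrite fsbig1.
split=> [i|]; first exact: subCstar0 (graded_sub gA i).
by apply: (sub_finite_set _ (@finite_set0 L)) => i /=; rewrite eqxx.
Qed.

Lemma alg_sumD x y : alg_sum N x -> alg_sum N y -> alg_sum N (x + y).
Proof.
move=> [S [SA Sfin] <-] [T [TA Tfin] <-].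
exists (fun i => S i + T i).
  split=> [i|]; first exact: subCstarD (graded_sub gA i) _ _ (SA i) (TA i).
  apply: (@sub_finite_set _ _ ([set i | S i != 0] `|` [set i | T i != 0])).
    move=> i /=; have [->|] := eqVneq (S i) 0; last by left.
    by rewrite add0r; right.
  by rewrite finite_setU.
pose D := N `&` ([set i | S i != 0] `|` [set i | T i != 0]).
have Dfin : finite_set D.
  by apply: finite_setIr; rewrite finite_setU.
have widen (U : L -> A) : (forall i, S i = 0 -> T i = 0 -> U i = 0) ->
    \sum_(i \in N) U i = \sum_(i \in D) U i.
  move=> U0; apply/esym/fsbig_widen; first by move=> i [].
  move=> i [Ni] /= Di; apply: U0; apply/eqP/negPn/negP => ST0; apply: Di.
    by split=> //; left.
  by split=> //; right.
rewrite (widen S)// (widen T)// (widen (fun i => S i + T i)).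
  exact: fsbig_split.
by move=> i -> ->; rewrite addr0.
Qed.

Lemma alg_sum_comp i a : N i -> A_ i a -> alg_sum N a.
Proof.
move=> Ni Aa; exists (fun j => if j == i then a else 0).
  split=> [j|].
    by case: eqP => [->|_] //; exact: subCstar0 (graded_sub gA j).
  apply: (sub_finite_set _ (@finite_set1 L i)) => j /=.
  by case: (eqVneq j i); rewrite // eqxx.
rewrite -(@fsbig_widen _ _ _ _ [set i]) ?fsbig_set1 ?eqxx//.
  by move=> j /= ->.
by move=> j [_ /= /eqP/negPf ->].
Qed.

Lemma alg_sum_sum (I : Type) (r : seq I) (P : pred I) (F : I -> A) :
  (forall k, P k -> alg_sum N (F k)) -> alg_sum N (\sum_(k <- r | P k) F k).
Proof.
by move=> FN; apply: big_ind => //; [exact: alg_sum0|exact: alg_sumD].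
Qed.

Lemma alg_sumZ (c : R[i]) x : alg_sum N x -> alg_sum N (c *: x).
Proof.
move=> [S SA <-]; have [r ->] := alg_sumE SA; rewrite scaler_sumr.
apply: alg_sum_sum => i /set_mem Ni; apply: (alg_sum_comp Ni).
exact: subCstarZ (graded_sub gA i) _ _ (SA.1 i).
Qed.

Lemma alg_sum_star x : alg_sum N x -> alg_sum N (cstar x).
Proof.
move=> [S SA <-]; have [r ->] := alg_sumE SA.
rewrite (big_morph _ (@cstarD _ A) (cstar0 A)).
apply: alg_sum_sum => i /set_mem Ni; apply: (alg_sum_comp Ni).
exact: subCstar_star (graded_sub gA i) _ (SA.1 i).
Qed.

Lemma alg_sumM : meet_stable N ->
  forall x y, alg_sum N x -> alg_sum N y -> alg_sum N (cmul x y).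
Proof.
move=> NI _ _ [S SA <-] [T TA <-].
have [r ->] := alg_sumE SA; have [s ->] := alg_sumE TA.
rewrite (big_morph _ (fun u v => cmulDl u v _) (cmul0r _)).
apply: alg_sum_sum => i /set_mem Ni.
rewrite (big_morph _ (cmulDr (S i)) (cmulr0 _)).
apply: alg_sum_sum => j /set_mem Nj; apply: (alg_sum_comp (NI _ _ Ni Nj)).
exact: graded_mul gA _ _ _ _ (SA.1 i) (TA.1 j).
Qed.

Lemma is_subCstar_closure_alg_sum : meet_stable N ->
  is_subCstar (closure (alg_sum N)).
Proof.
move=> NI; apply: is_subCstar_closure.
- exact: alg_sum0.
- exact: alg_sumD.
- exact: alg_sumZ.
- exact: alg_sumM.
- exact: alg_sum_star.
Qed.

Definition closed_alg_sum (NI : meet_stable N) : subCstar A :=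
  SubCstar (is_subCstar_closure_alg_sum NI).

End Graded.

(* Main.v *)
Require Import Defs.
From HB Require Import structures.
From mathcomp Require Import all_boot all_order all_algebra complex.
From mathcomp Require Import all_classical all_reals.
From mathcomp Require Import topology normedtype sequences.
From mathcomp Require Import ring lra.

(** On the algebraic sum of the components, the projection that forgets the
    components outside M is a homomorphism, because M is stable under meets
    and its complement absorbs meets with anything.  All the work lies in its
    contractivity, which makes it extend to the closure:

      |b| <= |b + j|   for b in the sum over M, j in the sum over ~M.   (1)

    Only finitely many components occur in b and j, and the subsemilattice they
    generate is finite ([meet_closure]), so (1) follows from an abstract fact
    about two complete pieces, [ideal_rnorm_le]: if B and J are closed
    self-adjoint subalgebras, BJ and JB lie in J and B, J meet only in 0, then
    |b| <= |b + j|.  Its hypothesis of closedness holds for finite sums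
    ([closed_alg_sum_seq]): a maximal index i of a finite semilattice can be
    removed, the component A_i is closed, the sum of the others is closed by
    induction and absorbs A_i, and (1) for this pair makes their sum closed
    ([closed_ideal_sum]).

    The abstract fact says that an injective homomorphism, here the map from
    B to the quotient by J, is isometric.  It is proved without spectral theory;
    the only analytic tool is the element g = 1 - sqrt(1 - w), defined for
    |w| <= 1 as the limit of the iteration g |-> (w + g^2)/2.  Suppose that (1)
    fails.  Taking powers of b* b gives a selfadjoint c in B of norm 1 which is
    congruent modulo J to an element c' of small norm.  Put k = 2c^2 and
    k' = 2c'^2.  On numbers k in [0,2], the function 1 - sqrt(1 - (2k - k^2)) is
    1 - |1 - k|: it is the identity for k <= 1, but never exceeds 1.  So on the
    small k' it returns k' itself ([sqrt_compl_unique]), while its value g at k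
    has norm at most 1.  As J absorbs B, k - g is congruent to 0 modulo J; it
    lies in B, so k = g has norm at most 1, although |k| = 2|c|^2 = 2.

    For the square root at k one needs |2k - k^2| <= 1, and the uniqueness of
    the projection needs homomorphisms to be contractive
    ([star_hom_rnorm]).  Both come from one observation ([rnorm_le1_circle]): if
    c and g are commuting selfadjoint elements with (1 - g)^2 + c^2 = 1, then
    multiplication by 1 - g + ic and by 1 - g - ic preserves norms, whence
    |c| <= 1.

    Once (1) is extended to the closures, their sum is closed and contains all
    components, so it is the whole algebra; (1) also shows that the sum is
    direct, and the projection onto the closed sum over M is the required
    homomorphism. *)

Set Implicit Arguments.
Unset Strict Implicit.
Unset Printing Implicit Defensive.

Import Order.TTheory GRing.Theory Num.Theory numFieldNormedType.Exports.

Local Open Scope classical_set_scope.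
Local Open Scope ring_scope.

(** * The norm as a real number *)

Section RealNorm.
Variables (R : realType) (A : cstarAlgType R).
Implicit Types (x y : A) (S : set A).

(** The norm takes values in R[i]; its real part carries the same information
    and makes arithmetic over an ordered field available. *)
Definition rnorm x : R := complex.Re `|x|.

Lemma rnormE x : `|x| = (rnorm x)%:C%C.
Proof. by rewrite /rnorm RRe_real// normr_real. Qed.

Lemma rnorm_ge0 x : 0 <= rnorm x.
Proof. by rewrite -lecR -rnormE normr_ge0. Qed.

Lemma rnorm_eq0 x : rnorm x = 0 -> x = 0.
Proof. by move=> x0; apply: normr0_eq0; rewrite rnormE x0. Qed.

Lemma rnorm0 : rnorm (0 : A) = 0.
Proof. by rewrite /rnorm normr0. Qed.

Lemma rnormN x : rnorm (- x) = rnorm x.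
Proof. by rewrite /rnorm normrN. Qed.

Lemma rnormD x y : rnorm (x + y) <= rnorm x + rnorm y.
Proof. by rewrite -lecR rmorphD /= -!rnormE ler_normD. Qed.

Lemma rnormB x y : rnorm (x - y) <= rnorm x + rnorm y.
Proof. by rewrite -(rnormN y) rnormD. Qed.

Lemma rnormM x y : rnorm (cmul x y) <= rnorm x * rnorm y.
Proof. by rewrite -lecR rmorphM /= -!rnormE norm_cmul. Qed.

Lemma rnormZ (c : R[i]) x : rnorm (c *: x) = complex.Re `|c| * rnorm x.
Proof.
apply: (@complexI R); rewrite rmorphM /= RRe_real ?normr_real//.
by rewrite -!rnormE normrZ.
Qed.

Lemma rnormZ_ge0 (t : R) x : 0 <= t -> rnorm (t%:C%C *: x) = t * rnorm x.
Proof.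
by move=> t0; rewrite rnormZ normc_def /= expr0n addr0 sqrtr_sqr ger0_norm.
Qed.

Lemma rnorm_double x : rnorm (x + x) = 2 * rnorm x.
Proof.
by rewrite -rnormZ_ge0// rmorphMn /= scaler_nat.
Qed.

Lemma rnorm_star x : rnorm (cstar x) = rnorm x.
Proof. by rewrite /rnorm norm_cstar. Qed.

Lemma rnorm_star_mul x : rnorm (cmul (cstar x) x) = rnorm x ^+ 2.
Proof.
by apply: (@complexI R); rewrite rmorphXn /= -!rnormE norm_cstar_mul.
Qed.

Lemma closure_rnormP S x :
  closure S x <-> forall e : R, 0 < e -> exists2 y, S y & rnorm (x - y) < e.
Proof.
rewrite closure_normP; split=> Sx e e0.
  have [|y Sy] := Sx e%:C%C; first by rewrite ltcR.
  by rewrite rnormE ltcR; exists y.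
have eE : e = (complex.Re e)%:C%C by rewrite RRe_real// gtr0_real.
have [|y Sy xy] := Sx (complex.Re e); first by rewrite -ltcR -eE.
by exists y => //; rewrite rnormE eE ltcR.
Qed.

Lemma closed_rnormP S x : closed S ->
  (forall e : R, 0 < e -> exists2 y, S y & rnorm (x - y) < e) -> S x.
Proof. by move=> Sc /closure_rnormP; apply: Sc. Qed.

(** A closed set that receives the image of S under a Lipschitz map receives the
    image of the closure of S as well. *)
Lemma lipschitz_closure S (T : set A) (f : A -> A) (k : R) x :
  closed T -> 0 <= k ->
  (forall y, rnorm (f x - f y) <= k * rnorm (x - y)) ->
  (forall y, S y -> T (f y)) -> closure S x -> T (f x).
Proof.
move=> Tc k0 fk fS /closure_rnormP Sx; apply: closed_rnormP Tc _ => e e0.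
have k1 : 0 < k + 1 by lra.
have [y Sy xy] := Sx _ (divr_gt0 e0 k1).
exists (f y); first exact: fS.
rewrite ltr_pdivlMr// in xy; apply: le_lt_trans (fk y) (le_lt_trans _ xy).
by rewrite mulrC ler_wpM2l ?rnorm_ge0//; lra.
Qed.

(** Completeness with an explicit rate, so that the limit inherits the bound. *)
Lemma complete_rnorm (u : nat -> A) (r : nat -> R) :
  (forall e, 0 < e -> exists n, r n < e) ->
  (forall n m, (n <= m)%N -> rnorm (u m - u n) <= r n) ->
  exists l, forall n, rnorm (l - u n) <= r n.
Proof.
move=> r0 ur.
have : cauchy (u @ \oo).
  apply: cauchy_exP => e e0.
  have eE : e = (complex.Re e)%:C%C by rewrite RRe_real// gtr0_real.
  have [|n rn] := r0 (complex.Re e); first by rewrite -ltcR -eE.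
  exists (u n), n => // m /= nm_; rewrite -ball_normE /=.
  rewrite distrC rnormE eE ltcR; exact: le_lt_trans (ur _ _ nm_) rn.
move=> /cauchy_cvg/cvg_ex[l ul]; exists l => n.
apply/ler_addgt0Pr => e e0.
have : nbhs l (ball l e%:C%C) by apply: nbhsx_ballx; rewrite ltcR.
move=> /ul[m _ ulm]; have := ulm (maxn n m) (leq_maxr _ _).
rewrite -ball_normE /= rnormE ltcR => lu.
rewrite -(subrK (u (maxn n m)) l) -addrA addrC.
apply: (le_trans (rnormD _ _)); apply: lerD; last exact: ltW.
exact: ur (leq_maxl _ _).
Qed.

End RealNorm.

(** * Subalgebras and homomorphisms *)

Section Subalgebras.
Variables (R : realType) (A : cstarAlgType R).
Implicit Types x y z : A.

Lemma cmulBl x y z : cmul (x - y) z = cmul x z - cmul y z.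
Proof. by rewrite cmulDl cmulNr. Qed.

Lemma cmulBr x y z : cmul z (x - y) = cmul z x - cmul z y.
Proof. by rewrite cmulDr cmulrN. Qed.

Lemma cstarB x y : cstar (x - y) = cstar x - cstar y.
Proof. by rewrite cstarD cstarN. Qed.

Lemma subCstarN (B : set A) x : is_subCstar B -> B x -> B (- x).
Proof. by move=> BP Bx; rewrite -scaleN1r; apply: (subCstarZ BP). Qed.

Lemma subCstarB (B : set A) x y : is_subCstar B -> B x -> B y -> B (x - y).
Proof. by move=> BP Bx By; apply: (subCstarD BP) => //; apply: subCstarN. Qed.

Lemma star_hom_subCstar_val (B : subCstar A) : star_hom (@subCstar_val R A B).
Proof.
by split=> // c x y; rewrite subCstar_valD subCstar_valZ.
Qed.

Lemma subCstar_val_surj (B : subCstar A) x : (B : set A) x ->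
  exists b : subCstar_type B, subCstar_val b = x.
Proof. by move=> /mem_set xB; exists (SubCstarElt xB). Qed.

Lemma subCstar_val_mem (B : subCstar A) (b : subCstar_type B) :
  (B : set A) (subCstar_val b).
Proof. by have /set_mem := subCstar_valP b. Qed.

End Subalgebras.

Section StarHom.
Variables (R : realType) (A B : cstarAlgType R) (q : A -> B).
Hypothesis hq : star_hom q.

Lemma star_homD x y : q (x + y) = q x + q y.
Proof. by case: hq => ql _ _; have := ql 1 x y; rewrite !scale1r. Qed.

Lemma star_hom0 : q 0 = 0.
Proof. by apply: (addIr (q 0)); rewrite -star_homD !add0r. Qed.

Lemma star_homZ (c : R[i]) x : q (c *: x) = c *: q x.
Proof. by case: hq => ql _ _; have := ql c x 0; rewrite star_hom0 !addr0. Qed.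

Lemma star_homB x y : q (x - y) = q x - q y.
Proof. by rewrite star_homD -scaleN1r star_homZ scaleN1r. Qed.

Lemma star_homM x y : q (cmul x y) = cmul (q x) (q y).
Proof. by case: hq. Qed.

Lemma star_hom_star x : q (cstar x) = cstar (q x).
Proof. by case: hq. Qed.

End StarHom.

(** * The element 1 - sqrt(1 - w) *)

Section SquareRoot.
Variables (R : realType) (A : cstarAlgType R).
Implicit Types (x y w c g : A).

(** The iteration defining 1 - sqrt(1 - w) at the number w = 1; it majorizes the
    one in the algebra for every w of norm at most 1. *)
Definition scalar_iter (n : nat) : R := iter n (fun t => (1 + t ^+ 2) / 2) 0.

Lemma scalar_iter_itv n : 0 <= scalar_iter n <= 1.
Proof.
elim: n => [|n /= /andP[p0 p1]]; first by rewrite /= lexx ler01.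
by apply/andP; split; nra.
Qed.

(** At w = 1 the iterates converge to 1 only like 2/n, the worst case for
    norm at most 1. *)
Definition rate (n : nat) : R := 2 / n.+2%:R.

Lemma rate_small e : 0 < e -> exists n, rate n < e.
Proof.
move=> e0; have [n ne] : exists n, 2 / e < n%:R.
  by exists (Num.bound (2 / e)); rewrite archi_boundP// divr_ge0// ltW.
exists n; rewrite /rate ltr_pdivrMr ?ltr0n// mulrC -ltr_pdivrMr//.
by rewrite (lt_trans ne)// ltr_nat.
Qed.

Lemma scalar_iter_rate n : 1 - scalar_iter n <= rate n.
Proof.
rewrite /rate; elim: n => [|n IH]; first by rewrite /= subr0 divff ?pnatr_eq0.
have /andP[p0 p1] := scalar_iter_itv n.
rewrite /=; move: (scalar_iter n) IH p0 p1 => p.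
rewrite -(@natr1 _ n.+2); have : 2 <= n.+2%:R :> R by rewrite ler_nat.
move: n.+2%:R => m m2; rewrite !ler_pdivlMr; try lra.
move=> IH p0 p1.
(* In terms of e = 1 - p the recursion is e |-> e - e^2/2, which increases on
   [0,1], and 2/m - 2/m^2 <= 2/(m+1). *)
pose e := 1 - p; have -> : p = 1 - e by rewrite /e; lra.
have : e * m <= 2 by [].
have : 0 <= e by rewrite /e; lra.
have : e <= 1 by rewrite /e; lra.
move: e => e e1 e0 em.
have -> : (1 - (1 + (1 - e) ^+ 2) / 2) * (m + 1)
    = (e - e ^+ 2 / 2) * (m + 1) by field.
nra.
Qed.

(** The iterates are polynomials in w without constant term and with nonnegative
    coefficients, so they stay in an algebra without unit and are controlled by
    their values at the number 1. *)
Definition sqrt_iter w (n : nat) : A :=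
  iter n (fun g => 2^-1 *: (w + cmul g g)) 0.

Lemma rnorm_half x : rnorm (2^-1 *: x) = rnorm x / 2.
Proof.
have -> : 2^-1 = (2^-1 : R)%:C%C by rewrite fmorphV rmorphMn.
by rewrite rnormZ_ge0 ?invr_ge0// mulrC.
Qed.

Lemma rnorm_sqrt_iter w n :
  rnorm w <= 1 -> rnorm (sqrt_iter w n) <= scalar_iter n.
Proof.
move=> w1; elim: n => [|n IH]; first by rewrite rnorm0.
rewrite /= rnorm_half; have := rnormD w (cmul (sqrt_iter w n) (sqrt_iter w n)).
have := rnormM (sqrt_iter w n) (sqrt_iter w n).
have := rnorm_ge0 (sqrt_iter w n).
rewrite -/(sqrt_iter w n) -/(scalar_iter n); nra.
Qed.

(** Consecutive differences satisfy
    2 (g'' - g') = g' (g' - g) + (g' - g) g, the noncommutative form of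
    g'^2 - g^2, and the numerical iteration satisfies the same identity. *)
Lemma rnorm_sqrt_iterS w n : rnorm w <= 1 ->
  rnorm (sqrt_iter w n.+1 - sqrt_iter w n) <= scalar_iter n.+1 - scalar_iter n.
Proof.
move=> w1; elim: n => [|n IH].
  by rewrite /= cmul0r addr0 subr0 rnorm_half subr0 expr0n addr0; lra.
have -> : sqrt_iter w n.+2 - sqrt_iter w n.+1 = 2^-1 *:
    (cmul (sqrt_iter w n.+1) (sqrt_iter w n.+1 - sqrt_iter w n)
   + cmul (sqrt_iter w n.+1 - sqrt_iter w n) (sqrt_iter w n)).
  rewrite cmulBr cmulBl addrA subrK [LHS]/= -scalerBr opprD addrACA.
  by rewrite subrr add0r.
rewrite rnorm_half.
have -> : scalar_iter n.+2 - scalar_iter n.+1 =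
   (scalar_iter n.+1 - scalar_iter n) * (scalar_iter n.+1 + scalar_iter n) / 2.
  by rewrite /=; field.
rewrite ler_pM2r ?invr_gt0// mulrDr; apply: (le_trans (rnormD _ _)).
apply: lerD; last first.
  apply: (le_trans (rnormM _ _)).
  by apply: ler_pM => //; rewrite ?rnorm_ge0// rnorm_sqrt_iter.
rewrite mulrC; apply: (le_trans (rnormM _ _)).
by apply: ler_pM => //; rewrite ?rnorm_ge0// rnorm_sqrt_iter.
Qed.

Lemma sqrt_iter_cauchy w n m : rnorm w <= 1 -> (n <= m)%N ->
  rnorm (sqrt_iter w m - sqrt_iter w n) <= rate n.
Proof.
move=> w1 /subnKC <-; move: (m - n)%N => k.
suff : rnorm (sqrt_iter w (n + k) - sqrt_iter w n)
    <= scalar_iter (n + k) - scalar_iter n.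
  have := scalar_iter_rate n; have /andP[_] := scalar_iter_itv (n + k); lra.
elim: k => [|k IH]; first by rewrite addn0 !subrr rnorm0.
rewrite addnS; have := rnormD (sqrt_iter w (n + k).+1 - sqrt_iter w (n + k))
  (sqrt_iter w (n + k) - sqrt_iter w n).
rewrite addrA subrK; have := rnorm_sqrt_iterS (n + k) w1; lra.
Qed.

Lemma rate_eq0 (k : R) x : (forall n, rnorm x <= k * rate n) -> x = 0.
Proof.
move=> xk; apply: rnorm_eq0; apply/le_anti; rewrite rnorm_ge0 andbT.
apply/ler_addgt0Pr => e e0; rewrite add0r.
have k1 : 0 < `|k| + 1 by have := normr_ge0 k; lra.
have [n rn] := rate_small (divr_gt0 e0 k1).
rewrite (le_trans (xk n))//; rewrite ltr_pdivlMr// in rn.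
have r0 : 0 <= rate n by rewrite divr_ge0.
have := ler_norm k; nra.
Qed.

Lemma half_double x : 2^-1 *: x + 2^-1 *: x = x.
Proof. by rewrite -scalerDl -[X in X + X]div1r -splitr scale1r. Qed.

(** The first clause is (1 - g)^2 = 1 - w, written without a unit.  The last one
    singles out the root reached by the iteration, through which g inherits
    whatever passes from w to all iterates. *)
Definition is_sqrt_compl w g :=
  [/\ g + g = w + cmul g g, rnorm g <= 1
    & forall n, rnorm (g - sqrt_iter w n) <= rate n].

Lemma sqrt_compl_exists w : rnorm w <= 1 -> exists g, is_sqrt_compl w g.
Proof.
move=> w1.
have [g gr] := complete_rnorm rate_small
  (fun n m => @sqrt_iter_cauchy w n m w1).
have g1 : rnorm g <= 1.
  apply/ler_addgt0Pr => e e0; have [n rn] := rate_small e0.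
  have := rnormD (g - sqrt_iter w n) (sqrt_iter w n); rewrite subrK.
  have := gr n; have := rnorm_sqrt_iter n w1.
  by have /andP[_] := scalar_iter_itv n; lra.
exists g; split => //; apply/eqP; rewrite -subr_eq0; apply/eqP.
apply: (@rate_eq0 4) => n.
set u := sqrt_iter w; have uS : w = (u n.+1 + u n.+1) - cmul (u n) (u n).
  by rewrite /u /= half_double addrK.
have -> : g + g - (w + cmul g g) =
   ((g - u n.+1) + (g - u n.+1)) - (cmul g (g - u n) + cmul (g - u n) (u n)).
  rewrite {1}uS cmulBr cmulBl [cmul g g - _ + _]addrA subrK.
  rewrite [(g - _) + _]addrACA -opprD -[RHS]addrA -opprD; congr (_ - _).
  by rewrite addrAC -addrA.
have := rnormB ((g - u n.+1) + (g - u n.+1))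
  (cmul g (g - u n) + cmul (g - u n) (u n)).
have := rnormD (g - u n.+1) (g - u n.+1).
have := rnormD (cmul g (g - u n)) (cmul (g - u n) (u n)).
have := rnormM g (g - u n); have := rnormM (g - u n) (u n).
have := rnorm_sqrt_iter n w1; have /andP[_] := scalar_iter_itv n.
have := gr n.+1; have := gr n; rewrite -/u.
have rS : rate n.+1 <= rate n by rewrite ler_pM2l ?lef_pV2 ?posrE ?ler_nat.
have := rnorm_ge0 (u n); have := rnorm_ge0 g; have := rnorm_ge0 (g - u n).
nra.
Qed.

Lemma sqrt_compl_commute w g c :
  is_sqrt_compl w g -> cmul c w = cmul w c -> cmul c g = cmul g c.
Proof.
move=> [_ _ gr] cw; apply/eqP; rewrite -subr_eq0; apply/eqP.
have cu n : cmul c (sqrt_iter w n) = cmul (sqrt_iter w n) c.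
  elim: n => [|n IH]; first by rewrite /= cmulr0 cmul0r.
  by rewrite /= cmulZr cmulZl cmulDr cmulDl cw cmulA IH -cmulA IH cmulA.
apply: (@rate_eq0 (rnorm c + rnorm c)) => n.
have -> : cmul c g - cmul g c =
    cmul c (g - sqrt_iter w n) - cmul (g - sqrt_iter w n) c.
  by rewrite cmulBl cmulBr cu opprB addrA subrK.
have := rnormB (cmul c (g - sqrt_iter w n)) (cmul (g - sqrt_iter w n) c).
have := rnormM c (g - sqrt_iter w n); have := rnormM (g - sqrt_iter w n) c.
by have := gr n; have := rnorm_ge0 c; nra.
Qed.

Lemma sqrt_compl_selfadjoint w g :
  is_sqrt_compl w g -> cstar w = w -> cstar g = g.
Proof.
move=> [_ _ gr] ww; apply/eqP; rewrite -subr_eq0; apply/eqP.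
have uu n : cstar (sqrt_iter w n) = sqrt_iter w n.
  elim: n => [|n IH]; first by rewrite /= cstar0.
  by rewrite /= cstarZ cstarD cstarM IH ww fmorphV rmorphMn rmorph1.
apply: (@rate_eq0 2) => n.
have -> : cstar g - g = cstar (g - sqrt_iter w n) - (g - sqrt_iter w n).
  by rewrite cstarB uu opprB addrA subrK.
have := rnormB (cstar (g - sqrt_iter w n)) (g - sqrt_iter w n).
by rewrite rnorm_star; have := gr n; lra.
Qed.

Lemma sqrt_compl_mem (B : set A) w g :
  is_subCstar B -> is_sqrt_compl w g -> B w -> B g.
Proof.
move=> BP [_ _ gr] Bw; apply: closed_rnormP (subCstar_closed BP) _ => e e0.
have [n rn] := rate_small e0.
exists (sqrt_iter w n); last exact: le_lt_trans (gr n) rn.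
elim: n {rn} => [|n IH]; first exact: subCstar0 BP.
by apply: (subCstarZ BP); apply: (subCstarD BP) => //; apply: (subCstarM BP).
Qed.

End SquareRoot.

(** * Norm estimates from Pythagoras *)

Section Pythagoras.
Variables (R : realType) (A : cstarAlgType R).
Implicit Types (x y c g a b : A).

Lemma rnorm_sqr_inj a b :
  cmul (cstar a) a = cmul (cstar b) b -> rnorm a = rnorm b.
Proof.
move=> ab; apply/eqP; rewrite -(@eqrXn2 _ 2) ?rnorm_ge0//.
by rewrite -!rnorm_star_mul ab.
Qed.

(** Under these hypotheses a + ib and a - ib both have the norm of y, and
    2ib is their difference. *)
Lemma rnorm_le_sum_squares a b y :
  cmul (cstar a) b = cmul (cstar b) a ->
  cmul (cstar a) a + cmul (cstar b) b = cmul (cstar y) y -> rnorm b <= rnorm y.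
Proof.
move=> ab aby.
have iso (s : R[i]) : s^* = - s -> s * s = -1 -> rnorm (a + s *: b) = rnorm y.
  move=> sN s2; apply: rnorm_sqr_inj; rewrite -aby.
  rewrite cstarD cstarZ sN cmulDl !cmulDr !cmulZr !cmulZl.
  rewrite !scalerA mulrN s2 opprK scale1r scaleNr -ab addrA; congr (_ + _).
  by rewrite addrK.
have ii : 'i * 'i = -1 :> R[i] by rewrite -expr2 sqrCi.
have iN : 'i^* = - 'i :> R[i] by rewrite conjCi.
have p := iso 'i iN ii.
have m : rnorm (a - 'i *: b) = rnorm y.
  rewrite -scaleNr; apply: iso; first by rewrite rmorphN /= iN.
  by rewrite mulrNN.
have := rnormB (a + 'i *: b) (a - 'i *: b).
have -> : a + 'i *: b - (a - 'i *: b) = 'i *: (b + b).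
  by rewrite opprB addrC addrA subrK scalerDr.
by rewrite p m rnormZ normCi /= mul1r rnorm_double; lra.
Qed.

(** The point (1 - g, c) lies on the unit circle.  Multiplication of y by
    u = 1 - g + ic and by its adjoint preserves the norm of y although u itself
    need not belong to the algebra; hence |cy| <= |y|, and y = c gives the
    bound. *)
Lemma rnorm_le1_circle c g : cstar c = c -> cstar g = g ->
  cmul c g = cmul g c -> g + g = cmul c c + cmul g g -> rnorm c <= 1.
Proof.
move=> cc gg cg g2.
have cy y : rnorm (cmul c y) <= rnorm y.
  apply: (@rnorm_le_sum_squares (y - cmul g y)).
    rewrite cstarB !cstarM cc gg cmulBl cmulBr -!cmulA; congr (_ - _).
    by rewrite !(cmulA _ _ y) cg.
  rewrite cstarB !cstarM cc gg cmulBl !cmulBr -!cmulA.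
  have -> : cmul (cstar y) (cmul c (cmul c y)) =
    cmul (cstar y) (cmul g y) + cmul (cstar y) (cmul g y) 
    - cmul (cstar y) (cmul g (cmul g y)).
    rewrite -cmulDr -cmulBr; congr cmul.
    by rewrite !(cmulA _ _ y) -cmulDl -cmulBl g2 addrK.
  by rewrite -[in X in _ + X]addrA -[X in X + _]addrA -opprD subrK.
have := cy c; rewrite -{1}cc rnorm_star_mul.
have := rnorm_ge0 c; nra.
Qed.

End Pythagoras.

(** For |u| <= 1 and c = u* u, the relation (1 - g)^2 + c^2 = 1 has a solution g
    that commutes with c; a homomorphism preserves this relation, which bounds
    the image of c, that is, the square of the norm of the image of u. *)
Lemma star_hom_rnorm (R : realType) (A B : cstarAlgType R) (q : A -> B) x :
  star_hom q -> rnorm (q x) <= rnorm x.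
Proof.
move=> hq.
have unit_ball u : rnorm u <= 1 -> rnorm (q u) <= 1.
  move=> u1; set c := cmul (cstar u) u.
  have cc : cstar c = c by rewrite cstarM cstarK.
  have c1 : rnorm c <= 1 by rewrite rnorm_star_mul; have := rnorm_ge0 u; nra.
  have [g sg] : exists g, is_sqrt_compl (cmul c c) g.
    by apply: sqrt_compl_exists; have := rnormM c c; have := rnorm_ge0 c; nra.
  have gg := sqrt_compl_selfadjoint sg _.
  have cg := sqrt_compl_commute (c := c) sg.
  have : rnorm (q c) <= 1.
    apply: (rnorm_le1_circle (g := q g)).
    - by rewrite -(star_hom_star hq) cc.
    - by rewrite -(star_hom_star hq) gg// cstarM cc.
    - by rewrite -!(star_homM hq) cg// cmulA.
    - by rewrite -!(star_homM hq) -!(star_homD hq); have [-> _ _] := sg.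
  rewrite (star_homM hq) (star_hom_star hq) rnorm_star_mul.
  by have := rnorm_ge0 (q u); nra.
have [x0|x0] := eqVneq (rnorm x) 0.
  by rewrite (rnorm_eq0 x0) (star_hom0 hq) !rnorm0.
have xp : 0 < rnorm x by rewrite lt_neqAle eq_sym x0 rnorm_ge0.
have := unit_ball (((rnorm x)^-1)%:C%C *: x).
rewrite (star_homZ hq) !rnormZ_ge0 ?invr_ge0 ?rnorm_ge0// mulVf// lexx.
move=> /(_ isT).
by rewrite mulrC ler_pdivrMr// mul1r.
Qed.

(** * Complementary ideals *)

Section Ideal.
Variables (R : realType) (A : cstarAlgType R).
Implicit Types (x y c g k : A).

(** If c = sin t then k = 2 sin^2 t and 2k - k^2 = sin^2 2t.  The proof realizes
    v = sin 2t = 2 c cos t with cos t = 1 - g obtained from the square root of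
    1 - c^2, and applies the circle argument to v and 1 - k = cos 2t. *)
Lemma rnorm_double_square c : cstar c = c -> rnorm c <= 1 ->
  forall k, k = cmul c c + cmul c c -> rnorm (k + k - cmul k k) <= 1.
Proof.
move=> cc c1 k kE; set h := cmul c c.
have [g sg] : exists g, is_sqrt_compl h g.
  by apply: sqrt_compl_exists; have := rnormM c c; have := rnorm_ge0 c; nra.
have hh : cstar h = h by rewrite cstarM cc.
have gg := sqrt_compl_selfadjoint sg hh.
have ch : cmul c h = cmul h c by rewrite cmulA.
have cg : cmul c g = cmul g c := sqrt_compl_commute sg ch.
have hg : cmul h g = cmul g h := sqrt_compl_commute sg erefl.
(* d = c cos t = (sin 2t) / 2. *)
pose d := c - cmul c g.
have dd : cmul d d = h - cmul h h.
  have [gE _ _] := sg.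
  rewrite /d cmulBl !cmulBr cmulA -/h.
  have -> : cmul (cmul c g) c = cmul h g by rewrite -cmulA -cg cmulA.
  have cgg : cmul c (cmul g g) = cmul (cmul g g) c.
    by rewrite cmulA cg -cmulA cg cmulA.
  have -> : cmul (cmul c g) (cmul c g) = cmul h (cmul g g).
    by rewrite {2}cg -cmulA [cmul g (cmul g c)]cmulA -cgg cmulA.
  have -> : cmul h h = cmul h g + (cmul h g - cmul h (cmul g g)).
    by rewrite addrA -cmulDr -cmulBr gE addrK.
  by rewrite ?cmulA -?/h ?opprD ?addrA.
have dh : cmul d h = cmul h d.
  rewrite /d cmulBl cmulBr ch -[cmul (cmul c g) h]cmulA -hg.
  by rewrite [cmul c (cmul h g)]cmulA ch -cmulA.
have dk : cmul d k = cmul k d by rewrite kE cmulDr [RHS]cmulDl dh.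
have quad x y :
    cmul (x + x) (y + y) = (cmul x y + cmul x y) + (cmul x y + cmul x y).
  by rewrite cmulDl !cmulDr.
have dbl x y : (x - y) + (x - y) = (x + x) - (y + y) by rewrite opprD addrACA.
have vv : cmul (d + d) (d + d) = k + k - cmul k k.
  by rewrite kE -/h !quad dd !dbl.
have v1 : rnorm (d + d) <= 1.
  apply: (rnorm_le1_circle (g := k)).
  - by rewrite cstarD cstarB cstarM cc gg -cg.
  - by rewrite kE cstarD hh.
  - by rewrite cmulDl cmulDr dk.
  - by rewrite vv subrK.
rewrite -vv; have := rnormM (d + d) (d + d); have := rnorm_ge0 (d + d); nra.
Qed.

(** The difference of two solutions satisfies 2(g - k) = (g - k)(g + k), where
    the norm of g + k is less than 2. *)
Lemma sqrt_compl_unique z g k : g + g = z + cmul g g -> k + k = z + cmul k k ->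
  cmul g k = cmul k g -> rnorm g <= 1 -> rnorm k < 1 -> g = k.
Proof.
move=> gE kE gk g1 k1; apply/eqP; rewrite -subr_eq0; apply/eqP.
have E : (g - k) + (g - k) = cmul (g - k) (g + k).
  rewrite addrACA -opprD gE kE opprD addrACA subrr add0r.
  by rewrite cmulBl !cmulDr gk opprD addrA addrK.
have := rnormM (g - k) (g + k); rewrite -E rnorm_double => yy.
apply: rnorm_eq0; have := rnormD g k; have := rnorm_ge0 (g - k).
by move=> ? ?; apply/le_anti; nra.
Qed.

Variables B J : set A.
Hypotheses (BP : is_subCstar B) (JP : is_subCstar J).
Hypothesis BJ : forall b j, B b -> J j -> J (cmul b j) /\ J (cmul j b).

(** Multiplication passes to the quotient by J; here and below, congruences
    modulo J replace the quotient algebra. *)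
Lemma ideal_mul_congr b b' x x' : B b -> B b' -> J (x - b) -> J (x' - b') ->
  J (cmul x x' - cmul b b').
Proof.
move=> Bb Bb' Jx Jx'.
have -> : cmul x x' - cmul b b' =
  cmul (x - b) (x' - b') + cmul (x - b) b' + cmul b (x' - b').
  by rewrite -cmulDr subrK cmulBl cmulBr addrA subrK.
apply: (subCstarD JP); last by have [] := BJ Bb Jx'.
apply: (subCstarD JP); last by have [] := BJ Bb' Jx.
exact: (subCstarM JP).
Qed.

Lemma ideal_add_congr b b' x x' :
  J (x - b) -> J (x' - b') -> J (x + x' - (b + b')).
Proof. by move=> Jx Jx'; rewrite opprD addrACA; apply: (subCstarD JP). Qed.

Lemma ideal_sqrt_compl_congr w w' g g' : B w -> J (w' - w) ->
  is_sqrt_compl w g -> is_sqrt_compl w' g' -> J (g' - g).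
Proof.
move=> Bw Jw [_ _ gr] [_ _ gr'].
apply: closed_rnormP (subCstar_closed JP) _ => e e0.
have [n rn] := rate_small (divr_gt0 e0 (@ltr0n R 2)).
exists (sqrt_iter w' n - sqrt_iter w n); last first.
  have -> : g' - g - (sqrt_iter w' n - sqrt_iter w n) =
      (g' - sqrt_iter w' n) - (g - sqrt_iter w n).
    by rewrite !opprD !opprK addrACA.
  have := rnormB (g' - sqrt_iter w' n) (g - sqrt_iter w n).
  by have := gr n; have := gr' n; lra.
suff [] : B (sqrt_iter w n) /\ J (sqrt_iter w' n - sqrt_iter w n) by [].
elim: n {rn} => [|n [IB IJ]].
  by rewrite /= subrr; split; [exact: subCstar0 BP|exact: subCstar0 JP].
rewrite /= -scalerBr; split.
  by apply: (subCstarZ BP); apply: (subCstarD BP) => //; apply: (subCstarM BP).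
by apply: (subCstarZ JP); apply: ideal_add_congr => //; apply: ideal_mul_congr.
Qed.

Hypothesis BJ0 : forall x, B x -> J x -> x = 0.

(** The contradiction at the heart of the proof: c of norm 1 in B cannot be
    congruent to a small element, because the square root construction sends
    2c^2 to an element of norm at most 1 and fixes the small element
    congruent to it. *)
Lemma ideal_separation c c' : cstar c = c -> B c -> J (c' - c) ->
  rnorm c = 1 -> rnorm c' <= 8^-1 -> False.
Proof.
move=> cc Bc Jc c1 c'8.
pose k := cmul c c + cmul c c; pose k' := cmul c' c' + cmul c' c'.
pose z := k + k - cmul k k; pose z' := k' + k' - cmul k' k'.
have Bk : B k by apply: (subCstarD BP); apply: (subCstarM BP).
have Jk : J (k' - k) by apply: ideal_add_congr; apply: ideal_mul_congr.
have Bz : B z.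
  apply: subCstarB => //; first exact: (subCstarD BP).
  exact: (subCstarM BP).
have Jz : J (z' - z).
  rewrite /z /z'.
  have -> : k' + k' - cmul k' k' - (k + k - cmul k k) =
     (k' + k' - (k + k)) - (cmul k' k' - cmul k k).
     by rewrite !opprD !opprK addrACA.
  by apply: subCstarB => //; [exact: ideal_add_congr|exact: ideal_mul_congr].
have z1 : rnorm z <= 1 by apply: (@rnorm_double_square c); rewrite ?c1.
(* 3^-1 leaves room for |z'| <= 2 |k'| + |k'|^2 <= 1. *)
have k'1 : rnorm k' <= 3^-1.
  rewrite rnorm_double; have := rnormM c' c'; have := rnorm_ge0 c'; nra.
have z'1 : rnorm z' <= 1.
  have := rnormB (k' + k') (cmul k' k'); rewrite rnorm_double.
  have := rnormM k' k'; have := rnorm_ge0 k'; rewrite /z'; nra.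
have [g sg] := sqrt_compl_exists z1; have [g' sg'] := sqrt_compl_exists z'1.
(* Both g' and k' solve the equation at z', and k' is small. *)
have g'k' : g' = k'.
  have [g'E g'1 _] := sg'; apply: (@sqrt_compl_unique z') => //.
  - by rewrite /z' subrK.
  - apply/esym/(sqrt_compl_commute sg'); rewrite /z'.
    move: k' {Jk Jz k'1 z'1 sg' g'E z'} => a.
    by rewrite cmulBr cmulBl cmulDr cmulDl cmulA.
  - by apply: le_lt_trans k'1 _; lra.
(* k - g lies in J, being congruent to k' - g' = 0. *)
have gk : g = k.
  apply/eqP; rewrite -subr_eq0; apply/eqP; apply: BJ0.
    by apply: subCstarB => //; exact: sqrt_compl_mem sg Bz.
  have -> : g - k = (k' - k) - (g' - g).
    by rewrite g'k' opprB [RHS]addrC addrA subrK.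
  by apply: subCstarB => //; exact: ideal_sqrt_compl_congr sg sg'.
have [_ + _] := sg; rewrite gk /k rnorm_double -{1}cc rnorm_star_mul c1; lra.
Qed.

(** Repeated squaring keeps the norm of a selfadjoint element of norm 1 equal to
    1, while the norm of a contraction congruent to it decays geometrically. *)
Lemma ideal_powers b b' r n : B b -> J (b' - b) -> rnorm b = 1 ->
    rnorm b' <= r -> r <= 1 ->
  exists c c', [/\ cstar c = c, B c, J (c' - c), rnorm c = 1
    & rnorm c' <= r ^+ n.+1].
Proof.
move=> Bb Jb b1 b'r r1; have r0 : 0 <= r := le_trans (rnorm_ge0 _) b'r.
elim: n => [|n [c [c' [cc Bc Jc c1 c'r]]]].
  exists (cmul (cstar b) b), (cmul (cstar b') b'); split.
  - by rewrite cstarM cstarK.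
  - by apply: (subCstarM BP) => //; apply: (subCstar_star BP).
  - apply: ideal_mul_congr => //; first exact: (subCstar_star BP).
    by rewrite -cstarB; apply: (subCstar_star JP).
  - by rewrite rnorm_star_mul b1 expr1n.
  - by rewrite rnorm_star_mul expr1; have := rnorm_ge0 b'; nra.
exists (cmul c c), (cmul c' c'); split.
- by rewrite cstarM cc.
- exact: (subCstarM BP).
- exact: ideal_mul_congr.
- by rewrite -{1}cc rnorm_star_mul c1 expr1n.
- apply: (le_trans (rnormM _ _)); rewrite exprS.
  apply: ler_pM => //; rewrite ?rnorm_ge0//.
  by apply: (le_trans c'r); rewrite exprS ler_piMr// exprn_ile1.
Qed.

(** The map from B to the quotient by J is isometric. *)
Theorem ideal_rnorm_le b j : B b -> J j -> rnorm b <= rnorm (b + j).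
Proof.
move=> Bb Jj; rewrite leNgt; apply/negP => lt.
have b0 : 0 < rnorm b := le_lt_trans (rnorm_ge0 _) lt.
(* Normalize b to norm 1; then b + j has norm r < 1. *)
pose t : R[i] := ((rnorm b)^-1)%:C%C.
have tE x : rnorm (t *: x) = rnorm x / rnorm b.
  by rewrite rnormZ_ge0 ?invr_ge0 ?rnorm_ge0// mulrC.
set r := rnorm (b + j) / rnorm b.
have r1 : r < 1 by rewrite ltr_pdivrMr// mul1r.
have r0 : 0 <= r by rewrite divr_ge0 ?rnorm_ge0.
have [n rn] : exists n, r ^+ n.+1 <= 8^-1.
  have /cvgrPdist_le/(_ 8^-1) : (r ^+ n @[n --> \oo] --> (0 : R))%R.
    by apply: cvg_expr; rewrite ger0_norm.
  rewrite invr_gt0 ltr0n => /(_ isT)[n _ /(_ n.+1)] /=.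
  rewrite sub0r normrN ger0_norm ?exprn_ge0// => h; exists n; exact: h.
have [] := @ideal_powers (t *: b) (t *: (b + j)) r n.
- exact: (subCstarZ BP).
- by rewrite -scalerBr addrAC subrr add0r; apply: (subCstarZ JP).
- by rewrite tE divff// gt_eqF.
- by rewrite tE.
- exact: ltW.
move=> c [c' [cc Bc Jc c1 c'r]].
exact: ideal_separation cc Bc Jc c1 (le_trans c'r rn).
Qed.

End Ideal.

(** * The sum of a subalgebra and a complementary ideal *)

Section IdealSum.
Variables (R : realType) (A : cstarAlgType R) (B J : set A).
Hypotheses (BP : is_subCstar B) (JP : is_subCstar J).
Hypothesis BJ : forall b j, B b -> J j -> J (cmul b j) /\ J (cmul j b).
Hypothesis rnorm_le : forall b j, B b -> J j -> rnorm b <= rnorm (b + j).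

(** The components in B of a convergent sequence of sums form a Cauchy sequence,
    since the projection onto B is contractive. *)
Lemma closed_ideal_sum : closed [set b + j | b in B & j in J].
Proof.
move=> x /closure_rnormP Sx.
have r0 n : 0 < rate R n by rewrite divr_gt0.
have /boolp.choice[bj bjP] : forall n, exists bj : A * A,
    [/\ B bj.1, J bj.2 & rnorm (x - (bj.1 + bj.2)) < rate R n].
  by move=> n; have [_ [b Bb [j Jj <-]] xbj] := Sx _ (r0 n); exists (b, j).
pose b n := (bj n).1; pose j n := (bj n).2.
have rS n m : (n <= m)%N -> rate R m <= rate R n.
  by move=> nm; rewrite ler_pM2l ?lef_pV2 ?posrE ?ler_nat.
have [l lb] : exists l, forall n, rnorm (l - b n) <= 2 * rate R n.
  apply: complete_rnorm => [e e0|n m nm].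
    by have [n rn] := rate_small (divr_gt0 e0 (@ltr0n R 2)); exists n; lra.
  have [Bm Jm xm] := bjP m; have [Bn Jn xn] := bjP n.
  apply: (le_trans (rnorm_le (subCstarB BP Bm Bn) (subCstarB JP Jm Jn))).
  have -> : b m - b n + (j m - j n) = (x - (b n + j n)) - (x - (b m + j m)).
    by rewrite addrACA -opprD opprB [RHS]addrC addrA subrK.
  by have := rnormB (x - (b n + j n)) (x - (b m + j m)); have := rS _ _ nm; lra.
have Bl : B l.
  apply: closed_rnormP (subCstar_closed BP) _ => e e0.
  have [n rn] := rate_small (divr_gt0 e0 (@ltr0n R 2)).
  by exists (b n); [have [] := bjP n|have := lb n; lra].
exists l => //; exists (x - l); last by rewrite addrC subrK.
apply: closed_rnormP (subCstar_closed JP) _ => e e0.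
have [n rn] := rate_small (divr_gt0 e0 (@ltr0n R 3)).
exists (j n); first by have [] := bjP n.
have -> : x - l - j n = (x - (b n + j n)) - (l - b n).
  rewrite opprB [b n - l]addrC [RHS]addrACA opprD.
  by rewrite [X in _ = _ + X]addrAC addNr add0r.
have := rnormB (x - (b n + j n)) (l - b n).
by have := lb n; have [_ _] := bjP n; lra.
Qed.

Lemma is_subCstar_ideal_sum : is_subCstar [set b + j | b in B & j in J].
Proof.
split; last exact: closed_ideal_sum.
- exists 0; first exact: subCstar0 BP.
  by exists 0; [exact: subCstar0 JP|rewrite addr0].
- move=> _ _ [b Bb [j Jj <-]] [b' Bb' [j' Jj' <-]].
  exists (b + b'); first exact: subCstarD BP _ _ Bb Bb'.
  by exists (j + j'); [exact: subCstarD JP _ _ Jj Jj'|rewrite addrACA].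
- move=> c _ [b Bb [j Jj <-]].
  exists (c *: b); first exact: subCstarZ BP _ _ Bb.
  by exists (c *: j); [exact: subCstarZ JP _ _ Jj|rewrite scalerDr].
- move=> _ _ [b Bb [j Jj <-]] [b' Bb' [j' Jj' <-]].
  exists (cmul b b'); first exact: subCstarM BP _ _ Bb Bb'.
  exists (cmul (b + j) (b' + j') - cmul b b'); last by rewrite addrC subrK.
  have addK (y z : A) : y + z - y = z by rewrite addrAC subrr add0r.
  by apply: (ideal_mul_congr JP BJ) => //; rewrite addK.
- move=> _ [b Bb [j Jj <-]].
  exists (cstar b); first exact: subCstar_star BP _ Bb.
  by exists (cstar j); [exact: subCstar_star JP _ Jj|rewrite cstarD].
Qed.

End IdealSum.

(** * Finite subsemilattices *)

Section FiniteSemilattice.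
Variables (d : Order.disp_t) (L : meetSemilatticeType d).

(** All meets of nonempty subfamilies of s. *)
Fixpoint meet_closure (s : seq L) : seq L :=
  if s is i :: s' then
    i :: meet_closure s' ++ [seq Order.meet i j | j <- meet_closure s']
  else [::].

Lemma sub_meet_closure (s : seq L) : {subset s <= meet_closure s}.
Proof.
elim: s => [//|i s IH] j; rewrite !inE => /orP[->//|/IH js].
by rewrite mem_cat js orbT.
Qed.

Lemma meet_stable_meet_closure (s : seq L) : meet_stable [set` meet_closure s].
Proof.
elim: s => [//|i s IH]; have {}IH j k : j \in meet_closure s ->
    k \in meet_closure s -> Order.meet j k \in meet_closure s by exact: IH.
suff H j k : j \in meet_closure (i :: s) -> k \in meet_closure s ->
    Order.meet j k \in meet_closure (i :: s) /\
    Order.meet j (Order.meet i k) \in meet_closure (i :: s).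
  have H1 j : j \in meet_closure (i :: s) ->
      Order.meet j i \in meet_closure (i :: s).
    rewrite /= !inE !mem_cat => /or3P[/eqP->|js|/mapP[k ks ->]].
    - by rewrite meetxx eqxx.
    - by rewrite meetC map_f ?orbT.
    - by rewrite meetAC meetxx map_f ?orbT.
  move=> j k /= jS; rewrite inE mem_cat => /or3P[/eqP->|ks|/mapP[k' k's ->]].
  - exact: H1.
  - by have [] := H j k jS ks.
  - by have [] := H j k' jS k's.
move=> + ks; rewrite /= !inE !mem_cat => /or3P[/eqP->|js|/mapP[l ls ->]].
- by rewrite meetA meetxx map_f ?orbT.
- by split; [rewrite IH//= orbT|rewrite meetCA map_f ?orbT// IH].
- split; first by rewrite -meetA map_f ?orbT// IH.
  by rewrite meetACA meetxx map_f ?orbT// IH.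
Qed.

Lemma exists_maximal (i : L) (s : seq L) :
  exists2 m, m \in i :: s & forall j, j \in i :: s -> (m <= j)%O -> j = m.
Proof.
elim: s i => [|k s IH] i.
  by exists i; rewrite ?mem_head// => j; rewrite inE => /eqP.
have [m ms max] := IH k; have [mi|mi] := boolP (m <= i)%O.
  exists i; first exact: mem_head.
  move=> j; rewrite inE => /orP[/eqP//|js ij].
  have jm := max _ js (le_trans mi ij).
  by apply/le_anti; rewrite ij andbT jm.
exists m; first by rewrite inE ms orbT.
move=> j; rewrite inE => /orP[/eqP->|]; last exact: max.
by rewrite (negbTE mi).
Qed.

End FiniteSemilattice.

(** * Sums of graded components *)

Section GradedSums.
Variables (R : realType) (A : cstarAlgType R).
Variables (d : Order.disp_t) (L : meetSemilatticeType d) (A_ : L -> set A).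
Hypothesis gA : graded A_.
Implicit Types (N M : set L).

Lemma alg_sum_support N x : alg_sum A_ N x ->
  exists r : seq L, [set` r] `<=` N /\
  exists2 S : L -> A, (forall i, A_ i (S i)) & x = \sum_(i <- r) S i.
Proof.
move=> [S SA <-]; have [r ->] := alg_sumE N SA.
exists [seq i <- r | i \in N]; split.
  by move=> i /=; rewrite mem_filter => /andP[/set_mem].
by exists S; [case: SA|rewrite big_filter].
Qed.

Lemma alg_sum_seq (r : seq L) (S : L -> A) N : (forall i, A_ i (S i)) ->
  [set` r] `<=` N -> alg_sum A_ N (\sum_(i <- r) S i).
Proof.
move=> SA rN; rewrite big_seq; apply: alg_sum_sum => // i ir.
by apply: (alg_sum_comp gA (i := i)) => //; exact: rN.
Qed.

Lemma alg_sum_sub N N' : N `<=` N' -> alg_sum A_ N `<=` alg_sum A_ N'.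
Proof.
move=> NN' x /alg_sum_support[r [rN [S SA ->]]].
by apply: alg_sum_seq => // i /rN /NN'.
Qed.

(** The difference of the two decompositions of x is a family that sums to 0; on
    disjoint sets of indices no cancellation between them can occur. *)
Lemma alg_sum_indep N N' x : N `&` N' = set0 ->
  alg_sum A_ N x -> alg_sum A_ N' x -> x = 0.
Proof.
move=> NN' [S [SA Sfin] <-] /(alg_sumZ gA (-1)).
rewrite scaleN1r => -[T [TA Tfin] xT].
(* T decomposes - x, so that the family U sums to x - x. *)
pose U i := patch (fun=> 0) N S i + patch (fun=> 0) N' T i.
have Ufin : finite_set [set i | U i != 0].
  apply: (@sub_finite_set _ _ ([set i | S i != 0] `|` [set i | T i != 0])).
    move=> i /=; rewrite /U /patch; have [->|] := eqVneq (S i) 0; last by left.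
    by rewrite if_same add0r; case: ifP => // _; [right|rewrite eqxx].
  by rewrite finite_setU.
have UA i : A_ i (U i).
  by apply: (subCstarD (graded_sub gA i)); rewrite /patch; case: ifP => // _;
    exact: subCstar0 (graded_sub gA i).
have U0 : \sum_(i \in setT) U i = 0.
  pose D := [set i | S i != 0] `|` [set i | T i != 0].
  have widen (V : L -> A) : (forall i, S i = 0 -> T i = 0 -> V i = 0) ->
      \sum_(i \in setT) V i = \sum_(i \in D) V i.
    move=> V0; apply/esym/fsbig_widen => // i [_] /= Di; apply: V0;
    apply/eqP/negPn/negP => ST0; apply: Di; by [left|right].
  rewrite widen; last by move=> i Si Ti; rewrite /U /patch Si Ti !if_same addr0.
  rewrite fsbig_split/=; last by rewrite finite_setU.
  rewrite -(widen (patch _ N S)) => [|i Si _]; last first.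
    by rewrite /patch Si if_same.
  rewrite -(widen (patch _ N' T)) => [|i _ Ti]; last first.
    by rewrite /patch Ti if_same.
  by rewrite -!fsbig_mkcond xT subrr.
have Uz := graded_indep gA (conj UA Ufin) U0.
apply: fsbig1 => i Ni; have := Uz i; rewrite /U /patch mem_set//.
rewrite ifF ?addr0//; apply/negP => /set_mem N'i.
by have : (N `&` N') i by []; rewrite NN'.
Qed.

Lemma alg_sum_setU N N' :
  alg_sum A_ (N `|` N') = [set b + j | b in alg_sum A_ N & j in alg_sum A_ N'].
Proof.
apply/seteqP; split=> x.
  move=> /alg_sum_support[r [rN [S SA ->]]].
  rewrite (bigID (fun i => i \in N)) /=.
  exists (\sum_(i <- r | i \in N) S i).
    rewrite -big_filter; apply: alg_sum_seq => // i /=.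
    by rewrite mem_filter => /andP[/set_mem].
  exists (\sum_(i <- r | i \notin N) S i) => //.
  rewrite -big_filter; apply: alg_sum_seq => // i /=.
  by rewrite mem_filter => /andP[/negP Ni /rN [/mem_set//|]].
move=> [b bN [j jN <-]]; apply: alg_sumD => //.
  by apply: alg_sum_sub bN => i; left.
by apply: alg_sum_sub jN => i; right.
Qed.

Lemma alg_sum_set1 i : alg_sum A_ [set i] = A_ i.
Proof.
apply/seteqP; split=> x; last exact: (alg_sum_comp gA (i := i)).
move=> /alg_sum_support[r [ri [S SA ->]]]; rewrite big_seq.
have iP := graded_sub gA i.
apply: big_ind => [|y z|j /ri /= ->//]; first exact: subCstar0 iP.
exact: subCstarD iP _ _.
Qed.

Lemma alg_sum_ideal N N' : (forall i j, N i -> N' j -> N' (Order.meet i j)) ->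
  forall b j, alg_sum A_ N b -> alg_sum A_ N' j ->
    alg_sum A_ N' (cmul b j) /\ alg_sum A_ N' (cmul j b).
Proof.
move=> NN' _ _ /alg_sum_support[r [rN [S SA ->]]]
  /alg_sum_support[s [sN [T TA ->]]].
split.
  rewrite (big_morph _ (fun u v => cmulDl u v _) (cmul0r _)) big_seq.
  apply: alg_sum_sum => // i ir.
  rewrite (big_morph _ (cmulDr (S i)) (cmulr0 _)) big_seq.
  apply: alg_sum_sum => // j js.
  apply: (alg_sum_comp gA (i := Order.meet i j)).
    by apply: NN'; [exact: rN|exact: sN].
  exact: (graded_mul gA).
rewrite (big_morph _ (fun u v => cmulDl u v _) (cmul0r _)) big_seq.
apply: alg_sum_sum => // j js.
rewrite (big_morph _ (cmulDr (T j)) (cmulr0 _)) big_seq.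
apply: alg_sum_sum => // i ir.
apply: (alg_sum_comp gA (i := Order.meet i j)).
  by apply: NN'; [exact: rN|exact: sN].
by rewrite meetC; exact: (graded_mul gA).
Qed.

Lemma is_subCstar_alg_sum N : meet_stable N -> closed (alg_sum A_ N) ->
  is_subCstar (alg_sum A_ N).
Proof.
move=> NI Nc; split=> //; [exact: alg_sum0|exact: alg_sumD|exact: alg_sumZ
  |exact: alg_sumM|exact: alg_sum_star].
Qed.

(** Induction on the number of indices, removing a maximal index i.  Maximality
    enters twice: a meet of two other indices is never i, so the rest is a
    semilattice, and a meet of i with another index is never i, so the rest
    absorbs the component of i. *)
Lemma closed_alg_sum_seq (r : seq L) : meet_stable [set` r] ->
  closed (alg_sum A_ [set` r]).
Proof.
have [n] := ubnP (size r); elim: n r => // n IH [_ rI|k r].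
  move=> x /closure_rnormP x0.
  have -> : x = 0; last exact: alg_sum0.
  apply: rnorm_eq0; apply/le_anti; rewrite rnorm_ge0 andbT.
  apply/ler_addgt0Pr => e e0.
  have [y /alg_sum_support[s [s0 [S _ ->]]]] := x0 _ e0.
  rewrite big_seq big1; first by rewrite subr0 add0r => /ltW.
  by move=> i /s0.
rewrite ltnS => rn rI; have [i ir imax] := exists_maximal k r.
move: (k :: r) rn rI ir imax => {k}r rn rI ir imax.
pose r' := [seq j <- r | j != i].
have rE : [set` r] = [set i] `|` [set` r'].
  apply/seteqP; split=> j /=; rewrite mem_filter.
    by case: eqVneq => [->|_ /=]; [left|right].
  by case=> [->//|/andP[]].
have ri' j : i \in r -> j \in r' -> Order.meet i j \in r'.
  move=> _; rewrite !mem_filter => /andP[ji jr]; rewrite rI// andbT.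
  apply: contra ji => /eqP/meet_idPl ij; exact/eqP/imax.
have r'I : meet_stable [set` r'].
  move=> j l /=; rewrite !mem_filter => /andP[ji jr] /andP[li lr].
  rewrite rI// andbT; apply: contra ji => /eqP jl.
  by apply/eqP/imax => //; rewrite -jl leIl.
have r'c : closed (alg_sum A_ [set` r']).
  apply: IH => //; apply: leq_trans rn; rewrite size_filter.
  rewrite -(count_predC (fun j => j != i) r) -[X in (X < _)%N]addn0 ltn_add2l.
  by rewrite -has_count; apply/hasP; exists i => //=; rewrite eqxx.
rewrite rE alg_sum_setU alg_sum_set1.
have r'P := is_subCstar_alg_sum r'I r'c.
have iP := graded_sub gA i.
have ideal b j : A_ i b -> alg_sum A_ [set` r'] j ->
    alg_sum A_ [set` r'] (cmul b j) /\ alg_sum A_ [set` r'] (cmul j b).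
  by rewrite -alg_sum_set1; apply: alg_sum_ideal => _ l -> /=; exact: ri'.
apply: closed_ideal_sum => //; apply: ideal_rnorm_le => // x.
rewrite -alg_sum_set1; apply: alg_sum_indep.
by apply/seteqP; split=> // j [/= ->]; rewrite mem_filter eqxx.
Qed.

(** The supports of b and j generate a finite subsemilattice, which M splits
    into two finite subsemilattices; the sums over these are closed. *)
Lemma alg_sum_rnorm_le M b j : final_subsemilattice M ->
  alg_sum A_ M b -> alg_sum A_ (~` M) j -> rnorm b <= rnorm (b + j).
Proof.
move=> fM /alg_sum_support[r [rM [S SA bE]]].
move=> /alg_sum_support[s [sM [T TA jE]]].
pose F := meet_closure (r ++ s).
have FI := @meet_stable_meet_closure _ _ (r ++ s).
have Fsub i : (i \in r) || (i \in s) -> i \in F.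
  by move=> irs; apply: sub_meet_closure; rewrite mem_cat.
pose r' := [seq i <- F | i \in M]; pose s' := [seq i <- F | i \notin M].
have r'I : meet_stable [set` r'].
  move=> i k /=; rewrite !mem_filter.
  move=> /andP[/set_mem Mi Fi] /andP[/set_mem Mk Fk].
  by rewrite FI// andbT; apply/mem_set; exact: fM.1.
have ls' i k : i \in F -> k \in s' -> Order.meet i k \in s'.
  rewrite !mem_filter => Fi /andP[/negP Mk Fk]; rewrite FI// andbT.
  apply/negP => /set_mem Mik; apply/Mk/mem_set.
  by apply: fM.2 Mik _; exact: leIr.
have s'I : meet_stable [set` s'].
  by move=> i k /= si; apply: ls'; move: si; rewrite mem_filter => /andP[].
have r'P := is_subCstar_alg_sum r'I (closed_alg_sum_seq r'I).
have s'P := is_subCstar_alg_sum s'I (closed_alg_sum_seq s'I).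
apply: (ideal_rnorm_le r'P s'P).
- apply: alg_sum_ideal => i k /=; rewrite mem_filter => /andP[_]; exact: ls'.
- move=> x; apply: alg_sum_indep; apply/seteqP; split=> // i [/=].
  by rewrite !mem_filter => /andP[->].
- rewrite bE; apply: alg_sum_seq => // i /= ir.
  by rewrite mem_filter Fsub ?ir// andbT; apply/mem_set/rM.
- rewrite jE; apply: alg_sum_seq => // i /= is_.
  rewrite mem_filter Fsub ?is_ ?orbT// andbT; apply/negP => /set_mem; exact: sM.
Qed.

Lemma closure_graded_span x : closure (lin_span (\bigcup_i A_ i)) x.
Proof.
move=> U; rewrite nbhsE => -[V [Vo Vx] VU].
have [y [Vy Sy]] := graded_total gA (ex_intro _ x Vx) Vo.
by exists y; split=> //; exact: VU.
Qed.

(** Homomorphisms are continuous, and the components span a dense subspace. *)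
Lemma star_hom_eq (B : cstarAlgType R) (p q : A -> B) :
  star_hom p -> star_hom q -> (forall i a, A_ i a -> p a = q a) -> p = q.
Proof.
move=> hp hq pq.
apply/funext => x; apply/eqP; rewrite -subr_eq0; apply/eqP.
apply: rnorm_eq0; apply/le_anti; rewrite rnorm_ge0 andbT.
apply/ler_addgt0Pr => e e0; rewrite add0r.
have /closure_rnormP := @closure_graded_span x.
move=> /(_ _ (divr_gt0 e0 (@ltr0n R 2)))[y [n [c [z [zA yE]]]] xy].
have pqy : p y = q y.
  rewrite yE; apply: (big_ind (fun w => p w = q w)).
    by rewrite (star_hom0 hp) (star_hom0 hq).
    by move=> u v pu pv; rewrite (star_homD hp) (star_homD hq) pu pv.
  move=> k _; rewrite (star_homZ hp) (star_homZ hq).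
  by have [i _ /pq->] := zA k.
have -> : p x - q x = p (x - y) - q (x - y).
  by rewrite (star_homB hp) (star_homB hq) pqy opprB addrA subrK.
have := rnormB (p (x - y)) (q (x - y)).
by have := star_hom_rnorm (x - y) hp; have := star_hom_rnorm (x - y) hq; lra.
Qed.

End GradedSums.

(** * The decomposition along a final subsemilattice *)

Section Decomposition.
Variables (R : realType) (A : cstarAlgType R).
Variables (d : Order.disp_t) (L : meetSemilatticeType d) (A_ : L -> set A).
Hypothesis gA : graded A_.
Variable M : set L.
Hypothesis fM : final_subsemilattice M.

Local Notation AM := (closure (alg_sum A_ M)).
Local Notation AM' := (closure (alg_sum A_ (~` M))).

Let AMP : is_subCstar AM :=
  is_subCstar_closure_alg_sum gA (final_meet_stable fM).
Let AMP' : is_subCstar AM' :=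
  is_subCstar_closure_alg_sum gA (final_meet_stableC fM).

Lemma closure_final_ideal b j :
  AM b -> AM' j -> AM' (cmul b j) /\ AM' (cmul j b).
Proof.
have ideal b0 j0 : alg_sum A_ M b0 -> alg_sum A_ (~` M) j0 ->
    alg_sum A_ (~` M) (cmul b0 j0) /\ alg_sum A_ (~` M) (cmul j0 b0).
  apply: alg_sum_ideal => // i k _ Mk Mik; apply: Mk.
  by apply: fM.2 Mik _; exact: leIr.
have M'c := subCstar_closed AMP'.
move=> Mb Mj; split.
  apply: (lipschitz_closure (f := cmul^~ j) M'c (rnorm_ge0 j) _ _ Mb).
    by move=> z; rewrite -cmulBl mulrC rnormM.
  move=> b0 Mb0.
  apply: (lipschitz_closure (f := cmul b0) M'c (rnorm_ge0 b0) _ _ Mj).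
    by move=> z; rewrite -cmulBr rnormM.
  by move=> j0 Mj0; apply: subset_closure; have [] := ideal _ _ Mb0 Mj0.
apply: (lipschitz_closure (f := cmul j) M'c (rnorm_ge0 j) _ _ Mb).
  by move=> z; rewrite -cmulBr rnormM.
move=> b0 Mb0.
apply: (lipschitz_closure (f := cmul^~ b0) M'c (rnorm_ge0 b0) _ _ Mj).
  by move=> z; rewrite -cmulBl mulrC rnormM.
by move=> j0 Mj0; apply: subset_closure; have [] := ideal _ _ Mb0 Mj0.
Qed.

Lemma closure_final_rnorm_le b j : AM b -> AM' j -> rnorm b <= rnorm (b + j).
Proof.
move=> /closure_rnormP Mb /closure_rnormP Mj; apply/ler_addgt0Pr => e e0.
have e3 : 0 < e / 3 by rewrite divr_gt0.
have [b0 Mb0 bb0] := Mb _ e3; have [j0 Mj0 jj0] := Mj _ e3.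
have := alg_sum_rnorm_le gA fM Mb0 Mj0.
have := rnormD (b - b0) b0; rewrite subrK.
have := rnormB (b + j) ((b - b0) + (j - j0)).
rewrite [b - b0 + _]addrACA -opprD subKr.
by have := rnormD (b - b0) (j - j0); rewrite addrACA -opprD; lra.
Qed.

Lemma closure_final_inter x : AM x -> AM' x -> x = 0.
Proof.
move=> Mx M'x; apply: rnorm_eq0; apply/le_anti; rewrite rnorm_ge0 andbT.
have := closure_final_rnorm_le Mx (subCstarN AMP' M'x).
by rewrite subrr rnorm0.
Qed.

Lemma closure_final_sum x : exists2 b, AM b & AM' (x - b).
Proof.
have sumP := is_subCstar_ideal_sum AMP AMP'
  closure_final_ideal closure_final_rnorm_le.
suff [b Mb [j Mj <-]] : [set b + j | b in AM & j in AM'] x.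
  by exists b => //; rewrite addrAC subrr add0r.
apply: (subCstar_closed sumP).
apply: closureS (@closure_graded_span _ _ _ _ _ gA x) => y.
move=> [n [c [z [zA ->]]]]; apply: big_ind => [|u v|k _].
- exact: subCstar0 sumP.
- exact: subCstarD sumP _ _.
apply: (subCstarZ sumP); have [i _ Ai] := zA k.
have [Mi|Mi] := pselect (M i).
  exists (z k); first by apply: subset_closure; apply: alg_sum_comp Mi Ai.
  by exists 0; rewrite ?addr0//; exact: subCstar0 AMP'.
exists 0; first exact: subCstar0 AMP.
exists (z k); last by rewrite add0r.
by apply: subset_closure; apply: alg_sum_comp Mi Ai.
Qed.

End Decomposition.

Theorem proposition2p4p1 (R : realType) (d : Order.disp_t)
    (L : meetSemilatticeType d) (A : cstarAlgType R) (A_ : L -> set A)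
    (gA : graded A_) (M : set L) (fM : final_subsemilattice M) :
  let AM := closed_alg_sum gA (final_meet_stable fM) in
  let AM' := closed_alg_sum gA (final_meet_stableC fM) in
  exists p : A -> subCstar_type AM,
    [/\ unique (fun q : A -> subCstar_type AM =>
          [/\ star_hom q,
              forall i a, M i -> A_ i a -> q a = a :> A
            & forall i a, (~` M) i -> A_ i a -> q a = 0]) p,
        hom_kernel p = closure (alg_sum A_ (~` M)),
        direct_sum_decomposition
          (closure (alg_sum A_ (~` M))) (closure (alg_sum A_ M))
      & split_exact (@subCstar_val R A AM') p (@subCstar_val R A AM)].
Proof.
move=> AM AM'; have AMP := subCstarP AM; have AMP' := subCstarP AM'.
have /boolp.choice[p pP] : forall x, exists b : subCstar_type AM,
    (AM' : set A) (x - subCstar_val b).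
  move=> x; have [b Mb M'b] := closure_final_sum gA fM x.
  by have [b' b'E] := subCstar_val_surj (B := AM) Mb; exists b'; rewrite b'E.
have p_eq x (b : subCstar_type AM) :
    (AM' : set A) (x - subCstar_val b) -> p x = b.
  move=> xb; apply: subCstar_val_inj; apply/eqP; rewrite -subr_eq0; apply/eqP.
  apply: (closure_final_inter gA fM).
    exact: (subCstarB AMP (subCstar_val_mem (p x)) (subCstar_val_mem b)).
  have -> : subCstar_val (p x) - subCstar_val b =
    (x - subCstar_val b) - (x - subCstar_val (p x)).
    by rewrite opprB [RHS]addrC addrA subrK.
  exact: (subCstarB AMP' xb (pP x)).
have p_hom : star_hom p.
  split=> [c x y|x y|x]; apply: p_eq.
  - rewrite subCstar_valD subCstar_valZ opprD addrACA -scalerBr.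
    by apply: (subCstarD AMP'); [apply: (subCstarZ AMP'); exact: pP|exact: pP].
  - apply: (ideal_mul_congr AMP' (closure_final_ideal gA fM)).
    + exact: (subCstar_val_mem (p x)).
    + exact: (subCstar_val_mem (p y)).
    + exact: pP.
    + exact: pP.
  - by rewrite /= -cstarB; apply: (subCstar_star AMP'); exact: pP.
have p_id b : p (subCstar_val b) = b.
  by apply: p_eq; rewrite subrr; exact: subCstar0 AMP'.
have p_ker : hom_kernel p = closure (alg_sum A_ (~` M)).
  apply/seteqP; split=> x; rewrite /hom_kernel /=.
    by move=> px; have := pP x; rewrite px subCstar_val0 subr0.
  by move=> xM; apply: p_eq; rewrite subCstar_val0 subr0.
have p_M i a : M i -> A_ i a -> p a = a :> A.
  move=> Mi Aa; have : (AM : set A) a.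
    by apply: subset_closure; apply: alg_sum_comp Mi Aa.
  by move=> /subCstar_val_surj[b <-]; rewrite p_id.
have p_M' i a : (~` M) i -> A_ i a -> p a = 0.
  move=> Mi Aa; have : hom_kernel p a; last by [].
  by rewrite p_ker; apply: subset_closure; apply: alg_sum_comp Mi Aa.
exists p; split=> //.
- split=> // q [q_hom q_M q_M']; apply: (star_hom_eq gA) => // i a Aa.
  have [Mi|Mi] := pselect (M i).
    by apply: subCstar_val_inj; rewrite (p_M _ _ Mi Aa) (q_M _ _ Mi Aa).
  by rewrite (p_M' _ _ Mi Aa) (q_M' _ _ Mi Aa).
- move=> a; exists (a - subCstar_val (p a), subCstar_val (p a)); split.
    by split=> /=; [exact: pP|exact: (subCstar_val_mem (p a))|rewrite subrK].
  move=> [u w] [/= Mu Mw ->].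
  have [b <-] := subCstar_val_surj (B := AM) Mw.
  by have -> : p (u + subCstar_val b) = b; [apply: p_eq|]; rewrite addrK.
- split; first by split=> //; exact: star_hom_subCstar_val.
  split=> //; first exact: subCstar_val_inj.
    apply/seteqP; rewrite p_ker; split=> [_ [j _ <-]|x xM'].
      exact: (subCstar_val_mem j).
    by have [j <-] := subCstar_val_surj (B := AM') xM'; exists j.
  by apply/seteqP; split=> // b _; exists (subCstar_val b).
Qed.
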